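(* Let $k$ be an integer with $3\le k\le 14$. Then $\mathcal{MR}\!\left(\frac{I_{5k}}{5k},\frac{I_{5k}}{5k}\right)=7k=\lfloor\sqrt{(5k)^2+(5k)^2-1}\rfloor$.
   Context: $\mathbb{M}_n$ is the algebra of complex $n\times n$ matrices with identity $I_n$. A linear map $\Phi:\mathbb{M}_{d_1}\to\mathbb{M}_{d_2}$ is completely positive (CP) if and only if $\Phi(X)=\sum_{j=1}^r V_j^*XV_j$ for some complex $d_1\times d_2$ matrices $V_j$; the smallest possible $r$ is the Choi-rank $CR(\Phi)$. $\Phi^*:\mathbb{M}_{d_2}\to\mathbb{M}_{d_1}$ is the dual map defined by $\mathrm{tr}(\Phi(X)^*Y)=\mathrm{tr}(X^*\Phi^*(Y))$. For $A_1\in\mathbb{M}_{d_1}$, $A_2\in\mathbb{M}_{d_2}$, let $\mathcal{CP}[\mathbb{M}_{d_1},\mathbb{M}_{d_2};A_1,A_2]$ be the convex set of all CP maps $\Phi:\mathbb{M}_{d_1}\to\mathbb{M}_{d_2}$ with $\Phi(I_{d_1})=A_2$ and $\Phi^*(I_{d_2})=A_1$, and let $\mathcal{MR}(A_1,A_2)=\sup\{CR(\Phi):\Phi\text{ is an extreme point of }\mathcal{CP}[\mathbb{M}_{d_1},\mathbb{M}_{d_2};A_1,A_2]\}$. $\lfloor a\rfloor$ is the largest integer not exceeding $a$. Here $d_1=d_2=5k$. *)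

(* Defs.v *)
From HB Require Import structures.
From mathcomp Require Import all_boot all_order all_algebra.
From mathcomp Require Export spectral.
From mathcomp Require Import all_classical all_reals ereal.
From mathcomp Require Export complex.

Set Implicit Arguments.
Unset Strict Implicit.
Unset Printing Implicit Defensive.

Import Order.TTheory GRing.Theory Num.Theory.

Local Open Scope classical_set_scope.
Local Open Scope ring_scope.
Local Open Scope complex_scope.
Local Open Scope sesquilinear_scope.

Section CPMaps.
Variables (R : realType) (d1 d2 : nat).
Local Notation C := R[i].

(* Complete positivity is taken in its operator-sum (Kraus) form. *)
Definition kraus_form (Phi : 'Hom('M[C]_d1, 'M[C]_d2)) (r : nat) : Prop :=
  exists V : 'I_r -> 'M[C]_(d1, d2),
    forall X, Phi X = \sum_(j < r) (V j)^t* *m X *m V j.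

Definition completely_positive (Phi : 'Hom('M[C]_d1, 'M[C]_d2)) : Prop :=
  exists r, kraus_form Phi r.

(* The default value 0 is only returned when [Phi] is not completely
   positive; see [choi_rankP]. *)
Definition choi_rank (Phi : 'Hom('M[C]_d1, 'M[C]_d2)) : nat :=
  xget 0%N [set r | kraus_form Phi r /\ forall s, kraus_form Phi s -> (r <= s)%N].

Lemma choi_rankP (Phi : 'Hom('M[C]_d1, 'M[C]_d2)) :
  completely_positive Phi ->
  kraus_form Phi (choi_rank Phi) /\
  forall s, kraus_form Phi s -> (choi_rank Phi <= s)%N.
Proof.
move=> [r0 Pr0]; rewrite /choi_rank.
apply: (@xgetPex _ 0%N
  [set r | kraus_form Phi r /\ forall s, kraus_form Phi s -> (r <= s)%N]).
have ex : exists r, `[< kraus_form Phi r >] by exists r0; apply/asboolP.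
case: (ex_minnP ex) => r /asboolP Pr minr; exists r; split=> // s Ps.
by apply: minr; apply/asboolP.
Qed.

Definition is_dual (Phi : 'Hom('M[C]_d1, 'M[C]_d2))
    (Psi : 'Hom('M[C]_d2, 'M[C]_d1)) : Prop :=
  forall X Y, \tr ((Phi X)^t* *m Y) = \tr (X^t* *m Psi Y).

Lemma dual_unique_exists (Phi : 'Hom('M[C]_d1, 'M[C]_d2)) :
  exists! Psi, is_dual Phi Psi.
Proof.
have trE (i j : 'I_d1) (Z : 'M[C]_d1) : \tr ((delta_mx i j)^t* *m Z) = Z i j.
  rewrite trmx_delta map_delta_mx /mxtrace (bigD1 j) //= big1 ?addr0 => [|l lj].
    rewrite mxE (bigD1 i) //= big1 ?addr0 ?mxE ?eqxx ?mul1r // => l li.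
    by rewrite mxE (negbTE li) andbF mul0r.
  by rewrite mxE big1 // => m _; rewrite mxE (negbTE lj) mul0r.
pose f (Y : 'M[C]_d2) : 'M[C]_d1 :=
  \matrix_(i, j) \tr ((Phi (delta_mx i j))^t* *m Y).
have f_lin : linear f.
  move=> a Y Z; apply/matrixP=> i j.
  by rewrite !mxE mulmxDr -scalemxAr mxtraceD mxtraceZ.
pose fL := GRing.isLinear.Build _ _ _ _ f f_lin.
pose F : {linear 'M[C]_d2 -> 'M[C]_d1} := HB.pack f fL.
exists (linfun F); split.
  move=> X Y; rewrite lfunE /=.
  have -> : (Phi X)^t* = \sum_i \sum_j (X i j)^* *: (Phi (delta_mx i j))^t*.
    rewrite {1}(matrix_sum_delta X) !linear_sum /= raddf_sum.
    apply: eq_bigr => i _; rewrite !linear_sum /= raddf_sum.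
    by apply: eq_bigr => j _; rewrite !linearZ /= map_mxZ.
  rewrite mulmx_suml linear_sum /= /mxtrace.
  under [RHS]eq_bigr do rewrite mxE.
  rewrite [RHS]exchange_big /=; apply: eq_bigr => i _.
  rewrite -/(mxtrace _) mulmx_suml linear_sum /=; apply: eq_bigr => j _.
  by rewrite !mxE -scalemxAl mxtraceZ.
move=> Psi dualPsi; apply/lfunP=> Y; rewrite lfunE /=; apply/matrixP=> i j.
by rewrite mxE dualPsi trE.
Qed.

Definition CP_set (A1 : 'M[C]_d1) (A2 : 'M[C]_d2) :
    set 'Hom('M[C]_d1, 'M[C]_d2) :=
  [set Phi | [/\ completely_positive Phi,
                 Phi 1%:M = A2
               & exists2 Psi, is_dual Phi Psi & Psi 1%:M = A1]].

End CPMaps.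

(* [E] is a complex vector space, but convex combinations use real weights,
   embedded in [R[i]] by [%:C]. *)
Definition extreme_points (R : realType) (E : lmodType R[i]) (S : set E) :
    set E :=
  [set x | S x /\ forall (y z : E) (t : R), S y -> S z -> 0 < t < 1 ->
     x = t%:C *: y + (1 - t)%:C *: z -> y = x /\ z = x].

Definition MR (R : realType) (d1 d2 : nat)
    (A1 : 'M[R[i]]_d1) (A2 : 'M[R[i]]_d2) : \bar R :=
  ereal_sup [set ((choi_rank Phi)%:R%:E : \bar R)
            | Phi in extreme_points (CP_set A1 A2)].

(* Main.v *)
(* Kraus operators V_1, ..., V_r give an extreme point of Choi-rank r exactly when
   the r^2 pairs (V_i^* V_j, V_j V_i^* ) are linearly independent. Both components
   have the same trace, so r^2 <= d_1^2 + d_2^2 - 1; if a dependency X existed for a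
   minimal Kraus family, one could take X Hermitian and scaled so that 1 - X >= 0 is
   singular and 1 + X >= 0, and Phi would be the midpoint of two maps of the set, one
   of them of smaller Choi-rank. With d_1 = d_2 = 5k and k <= 14 this gives r <= 7k.

   The value 7k is attained by V_(j, s) = E_j (x) W_s, suitably normalised. The W_s are
   k real symmetric k x k matrices (k >= 3) whose k^2 products W_s W_t form a basis of
   the full matrix algebra and whose squares sum to a scalar. This reduces independence
   to that of the seven 5 x 5 matrices E_j, the extremal case 7^2 = 5^2 + 5^2 - 1,
   which is a finite computation over the Gaussian integers. *)
From HB Require Import structures.
Require Import Defs.
From mathcomp Require Import all_boot all_order all_algebra.
From mathcomp Require Import all_classical all_reals ereal.
From mathcomp Require Import ring lra zify mxtens.

Set Implicit Arguments.
Unset Strict Implicit.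
Unset Printing Implicit Defensive.

Import Order.TTheory GRing.Theory Num.Theory.

Local Open Scope ring_scope.
Local Open Scope sesquilinear_scope.

(** * Operator-sum representations *)

Definition recombine (C : numClosedFieldType) (d1 d2 m r : nat)
    (Q : 'M[C]_(m, r)) (V : 'I_r -> 'M[C]_(d1, d2)) (k : 'I_m) : 'M[C]_(d1, d2) :=
  \sum_j Q k j *: V j.

Lemma recombine_ctr (C : numClosedFieldType) (d1 d2 m r : nat)
    (Q : 'M[C]_(m, r)) (V : 'I_r -> 'M[C]_(d1, d2)) (k : 'I_m) :
  (recombine Q V k)^t* = \sum_j (Q k j)^* *: (V j)^t*.
Proof.
rewrite /recombine linear_sum /= raddf_sum.
by apply: eq_bigr => j _; rewrite linearZ /= map_mxZ.
Qed.

(** [Q] enters only through its Gram matrix [Q^t* *m Q]. It may be rectangular, so Kraus families of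
    different lengths can be compared; the free [Y] covers both the map and its value at the
    identity. *)
Lemma recombine_in (C : numClosedFieldType) (d1 d2 m r : nat)
    (Q : 'M[C]_(m, r)) (V : 'I_r -> 'M[C]_(d1, d2)) (Y : 'M[C]_d1) :
  \sum_k (recombine Q V k)^t* *m Y *m recombine Q V k =
  \sum_i \sum_j (Q^t* *m Q) i j *: ((V i)^t* *m Y *m V j).
Proof.
under eq_bigr => k _.
  rewrite recombine_ctr !mulmx_suml.
  under eq_bigr => i _.
    rewrite -!scalemxAl mulmx_sumr scaler_sumr.
    under eq_bigr do rewrite -scalemxAr scalerA.
  over.
over.
rewrite exchange_big; apply: eq_bigr => i _ /=.
rewrite exchange_big; apply: eq_bigr => j _ /=.
by rewrite -scaler_suml !mxE; congr (_ *: _); apply: eq_bigr => k _; rewrite !mxE.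
Qed.

Lemma recombine_out (C : numClosedFieldType) (d1 d2 m r : nat)
    (Q : 'M[C]_(m, r)) (V : 'I_r -> 'M[C]_(d1, d2)) :
  \sum_k recombine Q V k *m (recombine Q V k)^t* =
  \sum_i \sum_j (Q^t* *m Q) i j *: (V j *m (V i)^t*).
Proof.
under eq_bigr => k _.
  rewrite recombine_ctr mulmx_sumr.
  under eq_bigr => i _.
    rewrite -scalemxAr mulmx_suml scaler_sumr.
    under eq_bigr do rewrite -scalemxAl scalerA.
  over.
over.
rewrite exchange_big; apply: eq_bigr => i _ /=.
rewrite exchange_big; apply: eq_bigr => j _ /=.
by rewrite -scaler_suml !mxE; congr (_ *: _); apply: eq_bigr => k _; rewrite !mxE.
Qed.

(* Completely positive when [P] is positive semidefinite: see [sandwich_recombine]. *)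
Definition sandwich (C : numClosedFieldType) (d1 d2 r : nat)
    (V : 'I_r -> 'M[C]_(d1, d2)) (P : 'M[C]_r) : 'Hom('M[C]_d1, 'M[C]_d2) :=
  \sum_i \sum_j P i j *: linfun (mulmxr (V j) \o mulmx ((V i)^t*)).

Lemma sandwichE (C : numClosedFieldType) (d1 d2 r : nat)
    (V : 'I_r -> 'M[C]_(d1, d2)) (P : 'M[C]_r) (Y : 'M[C]_d1) :
  sandwich V P Y = \sum_i \sum_j P i j *: ((V i)^t* *m Y *m V j).
Proof.
rewrite /sandwich sum_lfunE; apply: eq_bigr => i _.
by rewrite sum_lfunE; apply: eq_bigr => j _; rewrite scale_lfunE lfunE.
Qed.

Lemma sandwichD (C : numClosedFieldType) (d1 d2 r : nat)
    (V : 'I_r -> 'M[C]_(d1, d2)) (P Q : 'M[C]_r) :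
  sandwich V (P + Q) = sandwich V P + sandwich V Q.
Proof.
rewrite /sandwich -big_split; apply: eq_bigr => i _.
by rewrite -big_split; apply: eq_bigr => j _; rewrite !mxE scalerDl.
Qed.

Lemma sandwichZ (C : numClosedFieldType) (d1 d2 r : nat)
    (V : 'I_r -> 'M[C]_(d1, d2)) (a : C) (P : 'M[C]_r) :
  sandwich V (a *: P) = a *: sandwich V P.
Proof.
rewrite /sandwich scaler_sumr; apply: eq_bigr => i _.
by rewrite scaler_sumr; apply: eq_bigr => j _; rewrite !mxE scalerA.
Qed.

Lemma sum_scalar1mx (C : numClosedFieldType) (E : lmodType C) (r : nat)
    (F : 'I_r -> 'I_r -> E) :
  \sum_i \sum_j (1%:M : 'M[C]_r) i j *: F i j = \sum_i F i i.
Proof.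
apply: eq_bigr => i _; rewrite (bigD1 i) //= big1 ?addr0 => [|j ji].
  by rewrite mxE eqxx scale1r.
by rewrite mxE eq_sym (negbTE ji) scale0r.
Qed.

Lemma sandwich1E (C : numClosedFieldType) (d1 d2 r : nat)
    (V : 'I_r -> 'M[C]_(d1, d2)) (Y : 'M[C]_d1) :
  sandwich V 1%:M Y = \sum_j (V j)^t* *m Y *m V j.
Proof. by rewrite sandwichE sum_scalar1mx. Qed.

Lemma kraus_formP (R : realType) (d1 d2 r : nat)
    (Phi : 'Hom('M[R[i]]_d1, 'M[R[i]]_d2)) :
  kraus_form Phi r <-> exists V : 'I_r -> 'M[R[i]]_(d1, d2), Phi = sandwich V 1%:M.
Proof.
split=> [[V VE]|[V ->]]; exists V.
  by apply/lfunP => Y; rewrite VE sandwich1E.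
by move=> Y; rewrite sandwich1E.
Qed.

Lemma sandwich_recombine (C : numClosedFieldType) (d1 d2 m r : nat)
    (Q : 'M[C]_(m, r)) (V : 'I_r -> 'M[C]_(d1, d2)) :
  sandwich (recombine Q V) 1%:M = sandwich V (Q^t* *m Q).
Proof. by apply/lfunP => Y; rewrite sandwich1E recombine_in sandwichE. Qed.

(** By cyclicity of the trace the adjoint family [(V j)^t*] defines a dual, and duals are unique. *)
Lemma dual_sandwich1 (R : realType) (d1 d2 r : nat)
    (V : 'I_r -> 'M[R[i]]_(d1, d2)) (Psi : 'Hom('M[R[i]]_d2, 'M[R[i]]_d1)) :
  is_dual (sandwich V 1%:M) Psi -> Psi 1%:M = \sum_j V j *m (V j)^t*.
Proof.
pose Psi' := sandwich (fun j => (V j)^t*) 1%:M.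
have dual' : is_dual (sandwich V 1%:M) Psi'.
  move=> X Y; rewrite !sandwich1E !linear_sum /= raddf_sum mulmx_suml linear_sum /=.
  apply: eq_bigr => j _; rewrite trmxCK !trmx_mul !map_mxM /= trmxCK.
  by rewrite -!mulmxA mxtrace_mulC !mulmxA.
have [Psi0 [_ uniq]] := dual_unique_exists (sandwich V 1%:M).
move=> /uniq <-; rewrite (uniq _ dual') sandwich1E.
by apply: eq_bigr => j _; rewrite trmxCK mulmx1.
Qed.

Lemma CP_set_sandwich1 (R : realType) (d1 d2 r : nat)
    (V : 'I_r -> 'M[R[i]]_(d1, d2)) (A1 : 'M[R[i]]_d1) (A2 : 'M[R[i]]_d2) :
  CP_set A1 A2 (sandwich V 1%:M) <->
  \sum_j (V j)^t* *m V j = A2 /\ \sum_j V j *m (V j)^t* = A1.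
Proof.
have inE : sandwich V 1%:M 1%:M = \sum_j (V j)^t* *m V j.
  by rewrite sandwich1E; apply: eq_bigr => j _; rewrite mulmx1.
split=> [[_ V1 [Psi dualPsi Psi1]]|[V1 V2]].
  by rewrite -inE V1 -(dual_sandwich1 dualPsi) Psi1.
split; [by exists r; apply/kraus_formP; exists V | by rewrite inE|].
have [Psi [dualPsi _]] := dual_unique_exists (sandwich V 1%:M).
by exists Psi => //; rewrite (dual_sandwich1 dualPsi).
Qed.

Lemma kraus_drop (R : realType) (d1 d2 r : nat)
    (V : 'I_r -> 'M[R[i]]_(d1, d2)) (j0 : 'I_r) :
  V j0 = 0 -> kraus_form (sandwich V 1%:M) r.-1.
Proof.
move=> V0; exists (fun j => V (lift j0 j)) => Y.
by rewrite sandwich1E (bigD1_ord j0) //= V0 mulmx0 add0r.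
Qed.

(** * Extreme points from independent Kraus families *)

(** Bilinear, without conjugation, so that it agrees with the product of the row [mxvec V] and a
    column. *)
Definition mxpair (C : numClosedFieldType) (d1 d2 : nat) (Z V : 'M[C]_(d1, d2)) : C :=
  \sum_a \sum_b Z a b * V a b.

Lemma mxvec_pair (C : numClosedFieldType) (d1 d2 : nat) (V : 'M[C]_(d1, d2))
    (z : 'rV[C]_(d1 * d2)) :
  \sum_k mxvec V 0 k * z 0 k = mxpair (vec_mx z) V.
Proof.
rewrite /mxpair pair_big /= (reindex _ (curry_mxvec_bij d1 d2)).
by apply: eq_bigr => -[a b] _ /=; rewrite mxvecE mxE mulrC.
Qed.

(* The quadratic form of the Choi matrix of [Phi]. *)
Definition choi_form (C : numClosedFieldType) (d1 d2 : nat)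
    (Phi : 'Hom('M[C]_d1, 'M[C]_d2)) (Z : 'M[C]_(d1, d2)) : C :=
  \sum_a \sum_b \sum_a' \sum_b'
    Z a b * (Z a' b')^* * Phi (delta_mx a' a) b' b.

Lemma choi_formD (C : numClosedFieldType) (d1 d2 : nat)
    (Phi Psi : 'Hom('M[C]_d1, 'M[C]_d2)) (s t : C) (Z : 'M[C]_(d1, d2)) :
  choi_form (s *: Phi + t *: Psi) Z = s * choi_form Phi Z + t * choi_form Psi Z.
Proof.
rewrite /choi_form !mulr_sumr -big_split; apply: eq_bigr => a _ /=.
rewrite !mulr_sumr -big_split; apply: eq_bigr => b _ /=.
rewrite !mulr_sumr -big_split; apply: eq_bigr => a' _ /=.
rewrite !mulr_sumr -big_split; apply: eq_bigr => b' _ /=.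
by rewrite add_lfunE !scale_lfunE !mxE mulrDr !mulrA; congr (_ * _ + _ * _); ring.
Qed.

(** The Choi matrix of a Kraus sum is a sum of positive matrices of rank at most one, one for each
    operator, so the form vanishes only where every [V j] pairs to zero. *)
Lemma choi_form_sandwich1 (C : numClosedFieldType) (d1 d2 r : nat)
    (V : 'I_r -> 'M[C]_(d1, d2)) (Z : 'M[C]_(d1, d2)) :
  choi_form (sandwich V 1%:M) Z = \sum_j `|mxpair Z (V j)| ^+ 2.
Proof.
have sq j : `|mxpair Z (V j)| ^+ 2 = \sum_a \sum_b \sum_a' \sum_b'
    Z a b * V j a b * (Z a' b' * V j a' b')^*.
  rewrite normCK /mxpair mulr_suml; apply: eq_bigr => a _.
  rewrite mulr_suml; apply: eq_bigr => b _.
  rewrite rmorph_sum mulr_sumr; apply: eq_bigr => a' _.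
  by rewrite rmorph_sum mulr_sumr.
under [RHS]eq_bigr do rewrite sq.
rewrite [RHS]exchange_big; apply: eq_bigr => a _ /=.
rewrite [RHS]exchange_big; apply: eq_bigr => b _ /=.
rewrite [RHS]exchange_big; apply: eq_bigr => a' _ /=.
rewrite [RHS]exchange_big; apply: eq_bigr => b' _ /=.
rewrite sandwich1E summxE mulr_sumr; apply: eq_bigr => j _.
rewrite mxE (bigD1 a) //= big1 ?addr0 => [|c ca]; last first.
  by rewrite mxE big1 ?mul0r // => c' _; rewrite !mxE (negbTE ca) andbF mulr0.
rewrite mxE (bigD1 a') //= big1 ?addr0 => [|c ca]; last first.
  by rewrite !mxE (negbTE ca) mulr0.
by rewrite !mxE !eqxx rmorphM /=; ring.
Qed.

(* If [sandwich A 1%:M] is dominated by [sandwich V 1%:M], then the form of the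
   former vanishes wherever that of the latter does, which by duality forces
   each [A k] into the span of [V]. *)
Lemma dominated_recombine (C : numClosedFieldType) (d1 d2 r s : nat)
    (V : 'I_r -> 'M[C]_(d1, d2)) (A : 'I_s -> 'M[C]_(d1, d2))
    (m : nat) (B : 'I_m -> 'M[C]_(d1, d2)) (a b : C) :
  0 < a -> 0 <= b ->
  sandwich V 1%:M = a *: sandwich A 1%:M + b *: sandwich B 1%:M ->
  exists Q : 'M[C]_(s, r), A = recombine Q V.
Proof.
move=> a0 b0 VAB.
pose stack n (W : 'I_n -> 'M[C]_(d1, d2)) : 'M[C]_(n, d1 * d2) :=
  \matrix_(j < n) mxvec (W j).
have stackM n (W : 'I_n -> 'M[C]_(d1, d2)) p (K : 'M_(_, p)) k l :
    (stack n W *m K) k l = mxpair (vec_mx (col l K)^T) (W k).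
  by rewrite mxE -mxvec_pair; apply: eq_bigr => c _; rewrite !mxE.
have sAV : (stack s A <= stack r V)%MS.
  rewrite submxE; apply/eqP/matrixP => k l; rewrite stackM [RHS]mxE.
  (* [Z] is a column of the cokernel of the stacked [V], hence pairs to zero with each [V j]; the
     same has to be shown for [A k]. *)
  set Z := vec_mx _.
  have : choi_form (sandwich V 1%:M) Z = 0.
    rewrite choi_form_sandwich1 big1 // => j _.
    by rewrite /Z -stackM mulmx_coker mxE normr0 expr0n.
  have pos n (W : 'I_n -> 'M[C]_(d1, d2)) : 0 <= choi_form (sandwich W 1%:M) Z.
    by rewrite choi_form_sandwich1 sumr_ge0 // => j _; rewrite exprn_ge0.
  rewrite VAB choi_formD => /eqP; rewrite paddr_eq0 ?mulr_ge0 ?pos ?(ltW a0) //.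
  rewrite mulf_eq0 (gt_eqF a0) /= choi_form_sandwich1 => /andP[/eqP A0 _].
  have /psumr_eq0P := A0; move/(_ (fun j _ => exprn_ge0 _ (normr_ge0 _)) k isT).
  by move=> /eqP; rewrite sqrf_eq0 normr_eq0 => /eqP.
have [Q AQ] := submxP sAV; exists Q; apply: funext => k.
have := congr1 (row k) AQ; rewrite rowK row_mul => /(congr1 vec_mx).
rewrite mxvecK mulmx_sum_row linear_sum /= => ->.
by apply: eq_bigr => j _; rewrite linearZ /= rowK mxvecK mxE.
Qed.

(** One [X] has to solve both equations: this is independence of the pairs, which is weaker than
    independence on either side alone. *)
Definition kraus_independent (C : numClosedFieldType) (d1 d2 r : nat)
    (V : 'I_r -> 'M[C]_(d1, d2)) : Prop :=
  forall X : 'M[C]_r,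
    \sum_i \sum_j X i j *: ((V i)^t* *m V j) = 0 ->
    \sum_i \sum_j X i j *: (V j *m (V i)^t*) = 0 -> X = 0.

(** Equality of both sums says that [Q^t* *m Q - 1%:M] solves the two homogeneous equations of
    [kraus_independent]. *)
Lemma gram1_of_independent (C : numClosedFieldType) (d1 d2 r s : nat)
    (V : 'I_r -> 'M[C]_(d1, d2)) (Q : 'M[C]_(s, r)) :
  kraus_independent V ->
  \sum_k (recombine Q V k)^t* *m recombine Q V k = \sum_j (V j)^t* *m V j ->
  \sum_k recombine Q V k *m (recombine Q V k)^t* = \sum_j V j *m (V j)^t* ->
  Q^t* *m Q = 1%:M.
Proof.
move=> indV; under eq_bigr do rewrite -[_^t*]mulmx1.
rewrite recombine_in recombine_out => in1 out1.
apply/eqP; rewrite -subr_eq0; apply/eqP/indV.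
  rewrite -[RHS](subrr (\sum_j (V j)^t* *m V j)) -{1}in1 -(sum_scalar1mx (fun i j => (V i)^t* *m V j)).
  rewrite -sumrB; apply: eq_bigr => i _; rewrite -sumrB; apply: eq_bigr => j _.
  by rewrite mulmx1 !mxE scalerBl.
rewrite -[RHS](subrr (\sum_j V j *m (V j)^t*)) -{1}out1 -(sum_scalar1mx (fun i j => V j *m (V i)^t*)).
rewrite -sumrB; apply: eq_bigr => i _; rewrite -sumrB; apply: eq_bigr => j _.
by rewrite !mxE scalerBl.
Qed.

(** A minimal family recombines [V] by some [Q] with [Q^t* *m Q = 1%:M], and such a [Q] has at least
    [r] rows. *)
Lemma independent_choi_rank (R : realType) (d1 d2 r : nat)
    (V : 'I_r -> 'M[R[i]]_(d1, d2)) :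
  kraus_independent V -> choi_rank (sandwich V 1%:M) = r.
Proof.
move=> indV; have krV : kraus_form (sandwich V 1%:M) r by apply/kraus_formP; exists V.
have [/kraus_formP[A VA] minr] := choi_rankP (ex_intro _ r krV).
apply/eqP; rewrite eqn_leq minr //=.
(* The domination lemma expects two summands; the second one gets weight 0. *)
have VAA : sandwich V 1%:M = 1 *: sandwich A 1%:M + 0 *: sandwich A 1%:M.
  by rewrite scale1r scale0r addr0.
have [Q AQ] := dominated_recombine ltr01 (lexx 0) VAA.
have [E1 E2] : \sum_k (A k)^t* *m A k = \sum_j (V j)^t* *m V j /\
    \sum_k A k *m (A k)^t* = \sum_j V j *m (V j)^t*.
  by apply/CP_set_sandwich1; rewrite -VA; apply/CP_set_sandwich1.
rewrite AQ in E1 E2; have := gram1_of_independent indV E1 E2.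
move=> /(congr1 mxrank); rewrite mxrank1 => {1}<-.
exact: leq_trans (mxrankM_maxr _ _) (rank_leq_row _).
Qed.

(** Each term of a convex decomposition is dominated, so its Kraus operators recombine [V]. The
    constraints then force the Gram matrix to be the identity, so the term is the map itself. *)
Lemma independent_extreme (R : realType) (d1 d2 r : nat)
    (V : 'I_r -> 'M[R[i]]_(d1, d2)) (A1 : 'M[R[i]]_d1) (A2 : 'M[R[i]]_d2) :
  kraus_independent V -> CP_set A1 A2 (sandwich V 1%:M) ->
  extreme_points (CP_set A1 A2) (sandwich V 1%:M).
Proof.
move=> indV CPV; split=> //.
have half y z (a b : R[i]) : CP_set A1 A2 y -> CP_set A1 A2 z -> 0 < a -> 0 <= b ->
    sandwich V 1%:M = a *: y + b *: z -> y = sandwich V 1%:M.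
  move=> CPy [[m /kraus_formP[B ->]] _ _] a0 b0.
  have [[s /kraus_formP[A yA]] _ _] := CPy; rewrite yA => VAB.
  have [Q AQ] := dominated_recombine a0 b0 VAB.
  move: CPy; rewrite yA AQ => /CP_set_sandwich1[in1 out1].
  have /CP_set_sandwich1[in2 out2] := CPV.
  by rewrite sandwich_recombine (gram1_of_independent indV) ?in1 ?in2 ?out1 ?out2.
move=> y z t CPy CPz /andP[t0 t1] Vyz; split.
  apply: (half _ _ _ _ CPy CPz _ _ Vyz); first by rewrite ltcR.
  by rewrite lecR subr_ge0 ltW.
rewrite addrC in Vyz; apply: (half _ _ _ _ CPz CPy _ _ Vyz); last by rewrite lecR ltW.
by rewrite ltcR subr_gt0.
Qed.

(** * The upper bound *)

(** For Hermitian [X] these are the values at the identity of [sandwich V X] and of its dual, so a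
    Hermitian kernel element is a direction of perturbation that keeps both constraints. *)
Definition marginals (C : numClosedFieldType) (d1 d2 r : nat)
    (V : 'I_r -> 'M[C]_(d1, d2)) (X : 'M[C]_r) : 'M[C]_d2 * 'M[C]_d1 :=
  (\sum_i \sum_j X i j *: ((V i)^t* *m V j),
   \sum_i \sum_j X i j *: (V j *m (V i)^t*)).

Lemma marginals_linear (C : numClosedFieldType) (d1 d2 r : nat)
    (V : 'I_r -> 'M[C]_(d1, d2)) : linear (marginals V).
Proof.
move=> a X Y; rewrite /marginals.
by congr (_, _) => /=; rewrite scaler_sumr -big_split; apply: eq_bigr => i _ /=;
  rewrite scaler_sumr -big_split; apply: eq_bigr => j _ /=;
  rewrite !mxE scalerDl scalerA.
Qed.

Lemma marginals_ctr (C : numClosedFieldType) (d1 d2 r : nat)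
    (V : 'I_r -> 'M[C]_(d1, d2)) (X : 'M[C]_r) :
  marginals V (X^t*) = ((marginals V X).1^t*, (marginals V X).2^t*).
Proof.
by congr (_, _) => /=; rewrite exchange_big linear_sum raddf_sum;
  apply: eq_bigr => i _ /=; rewrite linear_sum raddf_sum;
  apply: eq_bigr => j _ /=;
  rewrite linearZ /= map_mxZ trmx_mul map_mxM trmxCK !mxE.
Qed.

Lemma mxtrace_marginals (C : numClosedFieldType) (d1 d2 r : nat)
    (V : 'I_r -> 'M[C]_(d1, d2)) (X : 'M[C]_r) :
  \tr (marginals V X).1 = \tr (marginals V X).2.
Proof.
rewrite !linear_sum; apply: eq_bigr => i _; rewrite !linear_sum.
by apply: eq_bigr => j _; rewrite /= !mxtraceZ mxtrace_mulC.
Qed.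

(* Both marginals have the same trace, so the range of [marginals V] is a
   proper subspace: this is the [- 1] under the square root. *)
Lemma marginals_kernel (C : numClosedFieldType) (d1 d2 r : nat)
    (V : 'I_r -> 'M[C]_(d1, d2)) :
  (0 < d2)%N -> (d1 ^ 2 + d2 ^ 2 <= r ^ 2)%N ->
  exists2 X : 'M[C]_r, X != 0 & marginals V X = 0.
Proof.
move=> d2_gt0 le_r.
pose fL := GRing.isLinear.Build _ _ _ _ _ (marginals_linear V).
pose F : {linear 'M[C]_r -> ('M[C]_d2 * 'M[C]_d1)%type} := HB.pack (marginals V) fL.
have FE X : linfun F X = marginals V X by rewrite lfunE.
have : (\dim (limg (linfun F)) < d1 ^ 2 + d2 ^ 2)%N.
  have := dimv_leqif_eq (subvf (limg (linfun F))).
  rewrite dimvf /dim /= -!mulnn addnC ltn_neqAle => -[-> ->]; rewrite andbT.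
  apply/negP => /eqP full.
  (* This pair has traces [d2] and 0, which differ because [d2] is positive. *)
  have /memv_imgP[X _] : (1%:M, 0) \in limg (linfun F) by rewrite full memvf.
  rewrite FE => E; have := mxtrace_marginals V X; rewrite -E /= mxtrace1 mxtrace0.
  by move=> /eqP; rewrite pnatr_eq0 eqn0Ngt d2_gt0.
have := limg_ker_dim (linfun F) fullv; rewrite capfv dimvf /dim /= mulnn => dimE.
move=> lt_img; have : lker (linfun F) != 0%VS.
  apply: contraTneq le_r => K0; rewrite K0 dimv0 add0n in dimE.
  by rewrite -ltnNge -dimE.
rewrite -vpick0 => X0; exists (vpick (lker (linfun F))) => //.
by have := memv_pick (lker (linfun F)); rewrite memv_ker FE => /eqP.
Qed.

(** The kernel is stable under adjoints and so contains [X + X^t*]; if that sum vanishes, [X] is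
    skew-Hermitian and ['i *: X] serves instead. *)
Lemma marginals_kernel_hermitian (C : numClosedFieldType) (d1 d2 r : nat)
    (V : 'I_r -> 'M[C]_(d1, d2)) :
  (0 < d2)%N -> (d1 ^ 2 + d2 ^ 2 <= r ^ 2)%N ->
  exists X : 'M[C]_r, [/\ X != 0, X^t* = X & marginals V X = 0].
Proof.
move=> d2_gt0 le_r; have [X X0 VX] := marginals_kernel V d2_gt0 le_r.
have VX' : marginals V (X^t*) = 0.
  by rewrite marginals_ctr VX /= !trmx0 !map_mx0.
have [XX|XX] := eqVneq (X + X^t*) 0.
  exists ('i *: X); split.
  - by rewrite scaler_eq0 negb_or neq0Ci.
  - rewrite linearZ /= map_mxZ /= conjCi scaleNr -scalerN.
    by congr (_ *: _); apply/esym/eqP; rewrite -addr_eq0 XX.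
  - have V0 : marginals V 0 = 0.
      by rewrite -(addNr X) -scaleN1r marginals_linear VX scaler0 addr0.
    by rewrite -[_ *: X]addr0 marginals_linear VX V0 scaler0 addr0.
exists (X + X^t*); split=> //.
  by rewrite linearD /= map_mxD trmxCK addrC.
by have := marginals_linear V 1 X (X^t*); rewrite scale1r VX VX' scaler0 addr0.
Qed.

(** Diagonalise [X] unitarily and take square roots of the shifted eigenvalues. Without the left
    unitary factor of the usual square root, a zero eigenvalue of [1%:M + c *: X] appears as a zero
    row of [Q]. *)
Lemma psd_shift_gram (C : numClosedFieldType) (n : nat) (X : 'M[C]_n) (c : C) :
  X^t* = X -> (forall i, 0 <= 1 + c * spectral_diag X 0 i) ->
  let Q := diag_mx (\row_i sqrtC (1 + c * spectral_diag X 0 i)) *m spectralmx X in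
  Q^t* *m Q = 1%:M + c *: X.
Proof.
move=> XX pos /=; set D := spectral_diag X; set U := spectralmx X.
have hX : X \is hermsymmx by apply/is_hermitianmxP; rewrite expr0 scale1r XX.
have UU : U^t* *m U = 1%:M.
  by rewrite -invmx_unitary ?spectral_unitarymx // mulVmx // spectral_unit.
have XE : X = U^t* *m diag_mx D *m U.
  by rewrite -invmx_unitary ?spectral_unitarymx //; apply/orthomx_spectralP/hermitian_normalmx.
set E := \row_i _.
have EE : (diag_mx E)^t* *m diag_mx E = 1%:M + c *: diag_mx D.
  rewrite tr_diag_mx map_diag_mx mulmx_diag -diag_const_mx -linearZ -linearD /=.
  congr diag_mx; apply/rowP => i; rewrite !mxE -/D.
  by rewrite (CrealP (ger0_real _)) ?sqrtC_ge0 // -expr2 sqrtCK.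
rewrite trmx_mul map_mxM mulmxA -[_ *m _ *m diag_mx E]mulmxA EE.
by rewrite mulmxDr mulmxDl mulmx1 UU -scalemxAr -scalemxAl -XE.
Qed.

(* Scaling a Hermitian [X] by the inverse of an eigenvalue of largest modulus
   makes [1 - c X] positive semidefinite and singular. *)
Lemma hermitian_boundary (C : numClosedFieldType) (n : nat) (X : 'M[C]_n) :
  X^t* = X -> X != 0 ->
  exists (c : C) (Q Q' : 'M[C]_n) (i0 : 'I_n),
    [/\ Q^t* *m Q = 1%:M - c *: X, Q'^t* *m Q' = 1%:M + c *: X & row i0 Q = 0].
Proof.
move=> XX X0; set D := spectral_diag X.
have hX : X \is hermsymmx by apply/is_hermitianmxP; rewrite expr0 scale1r XX.
have realD i : D 0 i \is Num.real.
  exact: (mxOverP (hermitian_spectral_diag_real hX)).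
have [i1 D1] : exists i, D 0 i != 0.
  apply/existsP; apply: contraNT X0 => /existsPn D0.
  rewrite (orthomx_spectralP (hermitian_normalmx hX)) -/D.
  have -> : D = 0 by apply/rowP => i; rewrite mxE; apply/eqP; have := D0 i; rewrite negbK.
  by rewrite linear0 mulmx0 mul0mx.
have [i0 _ maxD0] := @real_arg_maxP _ _ i1 xpredT (fun i => `|D 0 i|) isT
  (fun i _ => normr_real _).
have maxD i : `|D 0 i| <= `|D 0 i0| := maxD0 i isT.
have D0 : D 0 i0 != 0.
  by rewrite -normr_gt0 (lt_le_trans _ (maxD i1)) // normr_gt0.
(* [c] keeps the sign of the eigenvalue, so that [c * D 0 i0] is exactly 1. *)
set c := (D 0 i0)^-1; exists c.
have cD i : -1 <= c * D 0 i <= 1.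
  rewrite -real_ler_norml ?realM ?realV // normrM normfV mulrC.
  by rewrite ler_pdivrMr ?normr_gt0 // mul1r maxD.
have posN i : 0 <= 1 + - c * D 0 i.
  by rewrite mulNr subr_ge0; case/andP: (cD i).
have posP i : 0 <= 1 + c * D 0 i.
  by rewrite addrC -lerBlDr sub0r; case/andP: (cD i).
exists (diag_mx (\row_i sqrtC (1 + - c * D 0 i)) *m spectralmx X).
exists (diag_mx (\row_i sqrtC (1 + c * D 0 i)) *m spectralmx X).
exists i0; split.
- by rewrite (psd_shift_gram XX posN) scaleNr.
- exact: psd_shift_gram.
- by rewrite row_mul row_diag_mx mxE mulNr mulVf // subrr sqrtC0 scale0r mul0mx.
Qed.

Lemma extreme_choi_rank_lt (R : realType) (d1 d2 : nat)
    (A1 : 'M[R[i]]_d1) (A2 : 'M[R[i]]_d2) (Phi : 'Hom('M[R[i]]_d1, 'M[R[i]]_d2)) :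
  (0 < d2)%N -> extreme_points (CP_set A1 A2) Phi ->
  (choi_rank Phi ^ 2 < d1 ^ 2 + d2 ^ 2)%N.
Proof.
move=> d2_gt0 [CPPhi extr]; rewrite ltnNge; apply/negP => le_r.
have [cpPhi _ _] := CPPhi; have [] := choi_rankP cpPhi.
move: (choi_rank Phi) le_r => r le_r /kraus_formP[V PhiV] minr.
have [X [X0 XX VX]] := marginals_kernel_hermitian V d2_gt0 le_r.
have [c [Q [Q' [i0 [QQ Q'Q' Qi0]]]]] := hermitian_boundary XX X0.
have CPshift m (S : 'M_(m, _)) a : S^t* *m S = 1%:M + a *: X ->
    CP_set A1 A2 (sandwich V (1%:M + a *: X)).
  move=> SS; rewrite -SS -sandwich_recombine; apply/CP_set_sandwich1.
  move: CPPhi; rewrite PhiV => /CP_set_sandwich1[VA2 VA1].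
  have := marginals_linear V a X 1%:M; rewrite VX scaler0 add0r addrC -SS => -[].
  rewrite !sum_scalar1mx VA1 VA2 => in1 out1; split; last by rewrite recombine_out.
  under eq_bigr do rewrite -[_^t*]mulmx1.
  by rewrite recombine_in; under eq_bigr do under eq_bigr do rewrite mulmx1.
have half01 : 0 < (2^-1 : R) < 1 by apply/andP; split; lra.
rewrite -scaleNr in QQ.
(* [Phi] is the midpoint of the maps given by [1 - c X] and [1 + c X], so extremality identifies it
   with the first. *)
have [|Phi1 _] := extr _ _ _ (CPshift _ _ _ QQ) (CPshift _ _ _ Q'Q') half01.
  have -> : (1 - 2^-1 : R) = 2^-1 by lra.
  rewrite -scalerDr -sandwichD PhiV scaleNr addrACA addNr addr0 -mulr2n.
  rewrite -scaler_nat sandwichZ scalerA.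
  have -> : (2^-1 : R)%:C%C * 2 = 1 by rewrite -(rmorph_nat (real_complex R)) -rmorphM mulVf ?pnatr_eq0.
  by rewrite scale1r.
rewrite -QQ -sandwich_recombine in Phi1.
(* The zero row of [Q] kills one Kraus operator, and the remaining [r - 1] contradict minimality. *)
have V0 : recombine Q V i0 = 0.
  rewrite /recombine big1 // => j _; have /rowP/(_ j) := Qi0.
  by rewrite !mxE => ->; rewrite scale0r.
have := kraus_drop V0; rewrite Phi1 => /minr.
by have := ltn_ord i0; lia.
Qed.

(** * The symmetric factor *)

(* [a I + e_s 1^T + 1 e_s^T] with [a = - (k + 2) / 4], the value of [a] for which
   the squares sum to a scalar matrix. *)
Definition star_coef (C : numClosedFieldType) (k : nat) : C := - k.+2%:R / 4.

Definition star_mx (C : numClosedFieldType) (k : nat) (s : 'I_k) : 'M[C]_k :=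
  \matrix_(p, q) (star_coef C k *+ (p == q) + (p == s)%:R + (q == s)%:R).

Lemma star_coef_real (C : numClosedFieldType) (k : nat) : star_coef C k \is Num.real.
Proof. by rewrite /star_coef realM ?realN ?realV ?realn. Qed.

Lemma star_mx_ctr (C : numClosedFieldType) (k : nat) (s : 'I_k) :
  (star_mx C s)^t* = star_mx C s.
Proof.
apply/matrixP => p q; rewrite !mxE eq_sym !rmorphD !rmorph_nat rmorphMn /=.
by rewrite conj_Creal ?star_coef_real // addrAC.
Qed.

Lemma sum_star_mx (C : numClosedFieldType) (k : nat) (f : 'I_k -> C) (p m : 'I_k) :
  \sum_s f s * star_mx C s p m = (star_coef C k * \sum_s f s) *+ (p == m) + f p + f m.
Proof.
have pick (q : 'I_k) : \sum_s f s * (q == s)%:R = f q.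
  rewrite (bigD1 q) //= big1 ?addr0 ?eqxx ?mulr1 // => s sq.
  by rewrite eq_sym (negbTE sq) mulr0.
under eq_bigr do rewrite mxE !mulrDr.
rewrite !big_split /= !pick; congr (_ + _ + _).
by rewrite -mulrnAl mulr_sumr; apply: eq_bigr => s _; rewrite mulrC.
Qed.

(** Besides [X p q], the entry involves only row sums, column sums, the trace and the total of [X];
    summing it over a row, a column or the diagonal gives a closed linear system in these. *)
Lemma star_mx_comb (C : numClosedFieldType) (k : nat) (X : 'M[C]_k) (p q : 'I_k) :
  let a := star_coef C k in
  let u i := \sum_j X i j in let v j := \sum_i X i j in
  (\sum_s \sum_t X s t *: (star_mx C s *m star_mx C t)) p q =
  k%:R * X p q + u p + v q + \tr X + a * (u p + u q + v p + v q)
  + (a ^+ 2 * \sum_i u i) *+ (p == q).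
Proof.
move=> a u v; transitivity (\sum_m \sum_s (\sum_t X s t * star_mx C t m q) * star_mx C s p m).
  rewrite summxE [RHS]exchange_big; apply: eq_bigr => s _ /=; rewrite summxE.
  under [RHS]eq_bigr do rewrite mulr_suml.
  rewrite [RHS]exchange_big; apply: eq_bigr => t _ /=; rewrite !mxE mulr_sumr.
  by apply: eq_bigr => m _; ring.
have inner m : \sum_s (\sum_t X s t * star_mx C t m q) * star_mx C s p m =
    (a * ((a * \sum_i u i) *+ (m == q) + v m + v q)) *+ (p == m)
    + ((a * u p) *+ (m == q) + X p m + X p q)
    + ((a * u m) *+ (m == q) + X m m + X m q).
  under eq_bigr do rewrite sum_star_mx.
  rewrite sum_star_mx !big_split /=; congr ((_ * (_ + _ + _)) *+ _ + _ + _).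
  by rewrite mulr_sumr sumrMnl.
rewrite (eq_bigr _ (fun m _ => inner m)) !big_split /=.
have diag (b : 'I_k -> C) (p' : 'I_k) : \sum_m b m *+ (p' == m) = b p'.
  rewrite (bigD1 p') //= big1 ?addr0 ?eqxx // => m mp.
  by rewrite eq_sym (negbTE mp).
have diag' (b : 'I_k -> C) (p' : 'I_k) : \sum_m b m *+ (m == p') = b p'.
  by rewrite -[RHS]diag; apply: eq_bigr => m _; rewrite eq_sym.
rewrite diag !diag' sumr_const card_ord -/(u p) -/(v q) -/(\tr X) -(mulr_natl (X p q)).
move: (u p) (u q) (v p) (v q) (X p q) (\tr X) (\sum_i u i) (k%:R : C) => *.
by case: (p == q); rewrite ?mulr1n ?mulr0n; ring.
Qed.

(** For [X = 1] all row and column sums are 1 and the trace is [k], so the off-diagonal entries are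
    [k + 2 + 4 a], which is 0 by the choice of [a]. *)
Lemma star_mx_sqr_sum (C : numClosedFieldType) (k : nat) :
  \sum_(s < k) star_mx C s *m star_mx C s = (k%:R * (star_coef C k ^+ 2 + 1))%:M.
Proof.
rewrite -(sum_scalar1mx (fun s t => star_mx C s *m star_mx C t)).
apply/matrixP => p q; rewrite star_mx_comb mxtrace1 !mxE.
have row1 i : \sum_(j < k) (1%:M : 'M[C]_k) i j = 1.
  rewrite (bigD1 i) //= big1 ?addr0 ?mxE ?eqxx // => j ji.
  by rewrite mxE eq_sym (negbTE ji).
have col1 j : \sum_(i < k) (1%:M : 'M[C]_k) i j = 1.
  by rewrite -[RHS](row1 j); apply: eq_bigr => i _; rewrite !mxE eq_sym.
rewrite (eq_bigr _ (fun i _ => row1 i)) sumr_const card_ord !row1 !col1.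
have -> : star_coef C k = - (k%:R + 2) / 4 by rewrite /star_coef -natrD addn2.
by case: (p == q); rewrite ?mulr1n ?mulr0n; field.
Qed.

(** The row and column equations give [u = v]. The summed equations then yield in turn that the
    total [S], the trace and each [u p] vanish, which leaves [k X = 0]. *)
Lemma star_mx_independent (C : numClosedFieldType) (k : nat) (X : 'M[C]_k) :
  (2 < k)%N -> \sum_s \sum_t X s t *: (star_mx C s *m star_mx C t) = 0 -> X = 0.
Proof.
move=> k_gt2 X0; set a := star_coef C k.
pose u i := \sum_j X i j; pose v j := \sum_i X i j; pose S := \sum_i u i.
have sum_v : \sum_j v j = S by rewrite /S exchange_big.
have E p q : k%:R * X p q + u p + v q + \tr X + a * (u p + u q + v p + v q)
    + (a ^+ 2 * S) *+ (p == q) = 0.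
  by rewrite -star_mx_comb X0 mxE.
have diag (b : C) (p : 'I_k) : \sum_m b *+ (p == m) = b.
  rewrite (bigD1 p) //= big1 ?addr0 ?eqxx // => m mp.
  by rewrite eq_sym (negbTE mp).
have sum0 (F : 'I_k -> C) : (forall i, F i = 0) -> \sum_i F i = 0.
  by move=> F0; rewrite big1.
pose n : C := k%:R.
have mk (x : C) : x *+ k = n * x by rewrite mulr_natl.
have n_gt2 : 2 < n by rewrite ltr_nat.
have aE : a = - (n + 2) / 4 by rewrite /a /star_coef /n -natrD addn2.
have rowE p : (2 * n + a * n) * u p + a * n * v p
    = - ((1 + a) ^+ 2 * S + n * \tr X).
  have := sum0 _ (E p); rewrite !big_split /= -!mulr_sumr !big_split /= !sumr_const card_ord diag sum_v -/S -/(u p).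
  rewrite !mk => /eqP.
  by rewrite -subr_eq0 => /eqP H; apply/eqP; rewrite -subr_eq0 -H; apply/eqP; ring.
have colE q : (2 * n + a * n) * v q + a * n * u q
    = - ((1 + a) ^+ 2 * S + n * \tr X).
  have := sum0 _ (E^~ q); rewrite !big_split /= -!mulr_sumr !big_split /= !sumr_const card_ord sum_v -/S -/(v q).
  under [X in _ + X = _]eq_bigr do rewrite eq_sym.
  rewrite diag !mk => /eqP.
  by rewrite -subr_eq0 => /eqP H; apply/eqP; rewrite -subr_eq0 -H; apply/eqP; ring.
have trE : 2 * n * \tr X + (2 + 4 * a + n * a ^+ 2) * S = 0.
  have := sum0 _ (fun p => E p p).
  under eq_bigr do rewrite eqxx mulr1n.
  rewrite !big_split /= -!mulr_sumr !big_split /= !sumr_const card_ord sum_v -/S -/(\tr X).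
  by rewrite !mk => <-; ring.
have n0 : n != 0 by rewrite gt_eqF // (lt_trans _ n_gt2).
have uv p : v p = u p.
  apply/eqP; rewrite -subr_eq0; apply/eqP; apply: (mulfI (_ : 2 * n != 0)).
    by rewrite mulf_neq0 // pnatr_eq0.
  rewrite mulr0 -[RHS](subrr ((2 * n + a * n) * v p + a * n * u p)) {2}colE -(rowE p).
  ring.
have uE p : 2 * n * (1 + a) * u p = - ((1 + a) ^+ 2 * S + n * \tr X).
  by rewrite -(rowE p) uv; ring.
have SE : 2 * (1 + a) * S = - ((1 + a) ^+ 2 * S + n * \tr X).
  apply: (mulfI n0); transitivity (\sum_p 2 * n * (1 + a) * u p).
    by rewrite -mulr_sumr -/S; ring.
  by rewrite (eq_bigr _ (fun p _ => uE p)) sumr_const card_ord mk.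
have S0 : S = 0.
  (* Eliminating the trace between [trE] and [SE] leaves [(n - 2) (a^2 + 1) S = 0]; here [k > 2]
     matters, as it does for [1 + a != 0] below. *)
  have : (n - 2) * ((n + 2) ^+ 2 / 16 + 1) * S = 0.
    transitivity (2 * n * \tr X + (2 + 4 * a + n * a ^+ 2) * S
      - 2 * (2 * (1 + a) * S + (1 + a) ^+ 2 * S + n * \tr X)); last first.
      by rewrite trE SE; ring.
    by rewrite aE; field.
  move=> /eqP; rewrite !mulf_eq0 subr_eq0 (gt_eqF n_gt2) /= gt_eqF ?orbF.
    by move/eqP.
  by rewrite ltr_wpDl // divr_ge0 // exprn_ge0 // addr_ge0 // ltW // (lt_trans _ n_gt2).
have T0 : \tr X = 0.
  move: trE; rewrite S0 mulr0 addr0 => /eqP.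
  by rewrite !mulf_eq0 (negbTE n0) pnatr_eq0 => /eqP.
have u0 p : u p = 0.
  apply/eqP; have /eqP := uE p; rewrite S0 T0 !mulr0 addr0 oppr0 !mulf_eq0.
  rewrite (negbTE n0) pnatr_eq0 /= => /orP[|//].
  have -> : 1 + a = (2 - n) / 4 by rewrite aE; field.
  by rewrite mulf_eq0 invr_eq0 pnatr_eq0 orbF subr_eq0 lt_eqF.
apply/matrixP => p q; rewrite mxE; apply: (mulfI n0).
have := E p q; rewrite !uv !u0 T0 S0 mulr0 mul0rn -/n => e.
by rewrite mulr0 -[RHS]e; ring.
Qed.

(** * Seven five-by-five matrices *)

(* [(a, b)] encodes the Gaussian integer [a + i b], so that statements about
   matrices over the Gaussian integers can be decided by computation. *)
Definition gauss := (int * int)%type.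
Definition gadd (z w : gauss) : gauss := (z.1 + w.1, z.2 + w.2).
Definition gmul (z w : gauss) : gauss := (z.1 * w.1 - z.2 * w.2, z.1 * w.2 + z.2 * w.1).
Definition gconj (z : gauss) : gauss := (z.1, - z.2).
Definition gsum (s : seq gauss) : gauss := foldr gadd (0, 0) s.

Definition gauss_val (C : numClosedFieldType) (z : gauss) : C := z.1%:~R + 'i * z.2%:~R.

Lemma gauss_val_mul (C : numClosedFieldType) (z w : gauss) :
  gauss_val C (gmul z w) = gauss_val C z * gauss_val C w.
Proof.
rewrite /gauss_val /= !rmorphB !rmorphD !rmorphM /=.
have := sqrCi C; rewrite expr2 => ii.
set a := z.1%:~R; set b := z.2%:~R; set c := w.1%:~R; set d := w.2%:~R.
transitivity (a * c + 'i * 'i * (b * d) + 'i * (a * d + b * c)); last by ring.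
by rewrite ii; ring.
Qed.

Lemma gauss_val_conj (C : numClosedFieldType) (z : gauss) :
  gauss_val C (gconj z) = (gauss_val C z)^*.
Proof.
by rewrite /gauss_val !rmorphD !rmorphM /= conjCi !rmorph_int /= mulNr rmorphN mulrN.
Qed.

Lemma gauss_val_sum (C : numClosedFieldType) (s : seq gauss) :
  gauss_val C (gsum s) = \sum_(z <- s) gauss_val C z.
Proof.
elim: s => [|z s IHs]; first by rewrite big_nil /gauss_val mulr0 addr0.
by rewrite big_cons -IHs /gauss_val /= !rmorphD /=; ring.
Qed.

Lemma gauss_val_eq0 (C : numClosedFieldType) (z : gauss) :
  (gauss_val C z == 0) = (z == (0, 0)).
Proof.
case: z => a b; rewrite /gauss_val xpair_eqE -!(intr_eq0 C) /=.
have aR : (a%:~R : C) \is Num.real by rewrite realz.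
have bR : (b%:~R : C) \is Num.real by rewrite realz.
apply/eqP/andP => [z0|[/eqP-> /eqP->]]; last by rewrite mulr0 addr0.
by have := Re_rect aR bR; have := Im_rect aR bR; rewrite z0 !raddf0 => <- <-.
Qed.

(* Found by computer search among families graded by Z/6, the cell (a, b) having degree
   a + b + 2 and E_0, E_1 sharing degree 0: then the linear system splits according
   to degree differences, and outside the diagonal block it is triangular. Entries cannot
   all be real, for the antisymmetric coefficient matrices alone have dimension
   21 > 10 + 10. *)
Definition kraus5 (j a b : nat) : gauss :=
  match j, a, b with
  | 0, 0, 4 | 0, 1, 3 | 0, 4, 0 => (1, 0)%R
  | 0, 2, 2 => (1, 1)%R
  | 1, 1, 3 => (1, 0)%R
  | 1, 3, 1 => (2, 0)%R
  | 1, 4, 0 => (1, -1)%R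
  | 2, 1, 4 | 2, 2, 3 => (1, 1)%R
  | 2, 4, 1 => (-1, 0)%R
  | 3, 0, 0 | 3, 2, 4 | 3, 3, 3 => (1, 1)%R
  | 3, 4, 2 => (1, 0)%R
  | 4, 0, 1 | 4, 1, 0 => (1, 0)%R
  | 5, 0, 2 => (-1, 1)%R
  | 5, 4, 4 => (1, 0)%R
  | 6, 1, 2 => (1, 0)%R
  | _, _, _ => (0, 0)%R
  end%N.

(* The coefficient of [x_(i, j)] in the entry [(b, b')] of
   [\sum x_(i, j) E_i^* E_j], and in the entry [(b', b)] of
   [\sum x_(i, j) E_j E_i^*], where [E_j = kraus5 j]. *)
Definition kraus5_coef (side : bool) (b b' i j : nat) : gauss :=
  gsum [seq if side then gmul (gconj (kraus5 i a b)) (kraus5 j a b')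
            else gmul (gconj (kraus5 i b a)) (kraus5 j b' a) | a <- iota 0 5].

Definition combination := seq (bool * nat * nat * gauss).

Definition combine (s : combination) (i j : nat) : gauss :=
  gsum [seq gmul e.2 (kraus5_coef e.1.1.1 e.1.1.2 e.1.2 i j) | e <- s].

Definition index_pairs : seq (nat * nat) := [seq (i, j) | i <- iota 0 7, j <- iota 0 7].

(* Given that the unknowns in [known] vanish, the combination [s] of the equations
   isolates the unknown [t]. *)
Definition isolates (known : seq (nat * nat)) (t : nat * nat) (s : combination) : bool :=
  [&& t \in index_pairs, all (fun e => (e.1.1.2 < 5) && (e.1.2 < 5))%N s,
      combine s t.1 t.2 != (0, 0) &
      all (fun ij => [|| ij \in known, ij == t | combine s ij.1 ij.2 == (0, 0)])
          index_pairs].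

Fixpoint eliminated (known : seq (nat * nat)) (steps : seq (nat * nat * combination)) :
    seq (nat * nat) :=
  if steps is (t, s) :: steps' then
    if isolates known t s then eliminated (t :: known) steps' else known
  else known.

Definition single (i j : nat) (side : bool) (b b' : nat) : nat * nat * combination :=
  ((i, j), [:: (side, b, b', (1, 0))]).

(** The nine unknowns of degree difference 0 come first: the [(i, i)], [(0, 1)] and [(1, 0)]. The
    other forty then fall one equation at a time. [c] and [r] mark inner products of columns and of
    rows. *)
Definition kraus5_elimination : seq (nat * nat * combination) :=
  let c := true in let r := false in
  [:: ((5, 5), [:: (r, 0, 0, (2, 0)); (r, 2, 2, (-1, 0));
                   (c, 0, 0, (-2, 0)); (r, 4, 4, (2, 0))]);
    ((3, 3), [:: (c, 0, 0, (1, 0)); (r, 4, 4, (-1, 0)); (c, 1, 1, (-1, 0));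
                 (r, 3, 3, (1, 0)); (c, 4, 4, (2, 0)); (r, 2, 2, (-1, 0))]);
    single 1 1 r 3 3; ((2, 2), [:: (c, 4, 4, (2, 0)); (r, 2, 2, (-1, 0))]);
    single 4 4 c 1 1; single 0 0 r 2 2; single 6 6 c 2 2;
    ((0, 1), [:: (c, 0, 0, (1, 0)); (c, 3, 3, (-1, -1))]); single 1 0 c 3 3;
    single 1 2 r 3 4; single 1 3 c 1 3; single 1 4 r 3 0; single 2 1 r 4 3;
    single 2 3 r 2 3; single 4 5 c 1 2; single 3 1 c 3 1; single 3 2 r 3 2;
    single 5 4 c 2 1; single 4 1 r 0 3; single 0 2 c 3 4; single 6 0 r 1 2;
    single 6 1 c 2 3; single 3 4 c 0 1; single 0 3 r 1 3; single 3 5 r 2 4;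
    single 4 6 c 0 2; single 0 4 c 3 0; single 2 0 c 4 3; single 4 3 c 1 0;
    single 3 0 r 3 1; single 5 3 r 4 2; single 6 4 c 2 0; single 4 0 c 0 3;
    single 5 6 r 0 1; single 5 0 r 0 2; single 6 2 c 2 4; single 2 4 r 4 0;
    single 5 2 c 4 1; single 3 6 r 4 1; single 0 5 r 2 0; single 0 6 r 2 1;
    single 6 5 r 1 0; single 2 5 c 1 4; single 5 1 c 4 0; single 2 6 c 4 2;
    single 4 2 r 0 4; single 1 5 c 0 4; single 1 6 c 3 2; single 6 3 r 1 4].

(** Every step is rechecked in integer arithmetic, so the certificate is valid over every field
    [C]. *)
Lemma kraus5_elimination_complete :
  {subset index_pairs <= eliminated [::] kraus5_elimination}.
Proof.
have /allP : all (mem (eliminated [::] kraus5_elimination)) index_pairs by vm_compute.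
by [].
Qed.

(** In an accepted step every unknown other than [t] is already known to vanish or has coefficient
    0, and [t] has a nonzero coefficient. *)
Lemma eliminated_sound (C : numClosedFieldType) (x : nat -> nat -> C)
    (known : seq (nat * nat)) (steps : seq (nat * nat * combination)) :
  (forall side b b', (b < 5)%N -> (b' < 5)%N ->
    \sum_(ij <- index_pairs) gauss_val C (kraus5_coef side b b' ij.1 ij.2) * x ij.1 ij.2 = 0) ->
  (forall ij, ij \in known -> x ij.1 ij.2 = 0) ->
  forall ij, ij \in eliminated known steps -> x ij.1 ij.2 = 0.
Proof.
move=> eqs; elim: steps known => [|[t s] steps IHs] known known0 ij; first exact: known0.
rewrite /eliminated -/eliminated; case: ifP => [/and4P[t_in /seq.allP s_lt nz /seq.allP zeros]|_]; last exact: known0.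
apply: IHs => {}ij; rewrite inE => /predU1P[->|]; last exact: known0.
have : \sum_(uv <- index_pairs) gauss_val C (combine s uv.1 uv.2) * x uv.1 uv.2 = 0.
  under eq_bigr do rewrite gauss_val_sum big_map mulr_suml.
  rewrite exchange_big big_seq big1 //= => -[[[side b] b'] z] /s_lt /= /andP[b_lt b'_lt].
  under eq_bigr do rewrite gauss_val_mul -mulrA.
  by rewrite -mulr_sumr eqs ?mulr0.
rewrite (bigD1_seq t) //= big_seq_cond big1 => [|uv /andP[uv_in uv_t]].
  by rewrite addr0 => /eqP; rewrite mulf_eq0 gauss_val_eq0 (negbTE nz) => /eqP.
have := zeros _ uv_in; rewrite (negbTE uv_t) => /orP[/known0->|/eqP->].
  by rewrite mulr0.
by rewrite /gauss_val /= mulr0 addr0 mul0r.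
Qed.

Definition kraus5_mx (C : numClosedFieldType) (j : 'I_7) : 'M[C]_5 :=
  \matrix_(a, b) gauss_val C (kraus5 j a b).

Lemma big_iota_ord (V : nmodType) (n : nat) (F : nat -> V) :
  \sum_(i <- iota 0 n) F i = \sum_(i < n) F i.
Proof. by rewrite -(big_mkord xpredT F) /index_iota subn0. Qed.

Lemma kraus5_coefE (C : numClosedFieldType) (i j : 'I_7) (b b' : 'I_5) :
  ((kraus5_mx C i)^t* *m kraus5_mx C j) b b' =
    gauss_val C (kraus5_coef true b b' i j) /\
  (kraus5_mx C j *m (kraus5_mx C i)^t*) b' b =
    gauss_val C (kraus5_coef false b b' i j).
Proof.
by split; rewrite /kraus5_coef gauss_val_sum !big_map big_iota_ord mxE;
  apply: eq_bigr => a _; rewrite !mxE gauss_val_mul gauss_val_conj // mulrC.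
Qed.

Lemma kraus5_independent (C : numClosedFieldType) : kraus_independent (kraus5_mx C).
Proof.
(* The checker indexes by natural numbers; [inord] extends [X], and [index_pairs] stays below 7. *)
move=> X inX outX; pose x i j := X (inord i) (inord j).
have x0 ij : ij \in index_pairs -> x ij.1 ij.2 = 0.
  move/kraus5_elimination_complete; apply: eliminated_sound => [|ij']; last first.
    by rewrite in_nil.
  move=> side b b' b_lt b'_lt; rewrite /index_pairs big_allpairs big_iota_ord.
  under eq_bigr do rewrite big_iota_ord.
  transitivity (\sum_(i < 7) \sum_(j < 7) gauss_val C (kraus5_coef side b b' i j) * X i j).
    by apply: eq_bigr => i _; apply: eq_bigr => j _; rewrite /x !inord_val.
  pose o := Ordinal b_lt; pose o' := Ordinal b'_lt; case: side.
    have /matrixP/(_ o o') := inX; rewrite summxE [RHS]mxE => e; rewrite -[RHS]e.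
    apply: eq_bigr => i _; rewrite summxE; apply: eq_bigr => j _.
    by rewrite mxE (kraus5_coefE C i j o o').1 mulrC.
  have /matrixP/(_ o' o) := outX; rewrite summxE [RHS]mxE => e; rewrite -[RHS]e.
  apply: eq_bigr => i _; rewrite summxE; apply: eq_bigr => j _.
  by rewrite mxE (kraus5_coefE C i j o o').2 mulrC.
apply/matrixP => i j; rewrite mxE.
have := x0 (val i, val j); rewrite /x !inord_val; apply; apply/allpairsP.
by exists (val i, val j); split; rewrite // mem_iota ltn_ord.
Qed.

Lemma kraus5_marginals (C : numClosedFieldType) :
  \sum_j (kraus5_mx C j)^t* *m kraus5_mx C j = 6%:R%:M /\
  \sum_j kraus5_mx C j *m (kraus5_mx C j)^t* = 6%:R%:M.
Proof.
have diag side (b b' : 'I_5) : \sum_(j < 7) gauss_val C (kraus5_coef side b b' j j)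
    = (6%:R%:M : 'M[C]_5) b b'.
  have : all (fun b => all (fun b' => all (fun side : bool =>
      gsum [seq kraus5_coef side b b' j j | j <- iota 0 7] ==
      (if b == b' then 6 else 0, 0)) [:: true; false]) (iota 0 5)) (iota 0 5).
    by vm_compute.
  have side_in : side \in [:: true; false] by case: side.
  move=> /allP/(_ _ (_ : val b \in _)); rewrite mem_iota ltn_ord => /(_ isT).
  move=> /allP/(_ _ (_ : val b' \in _)); rewrite mem_iota ltn_ord => /(_ isT).
  move=> /allP/(_ side side_in)/eqP.
  move=> /(congr1 (gauss_val C)); rewrite gauss_val_sum big_map big_iota_ord => ->.
  rewrite mxE /gauss_val mulr0 addr0 -val_eqE /=.
  by case: (val b == val b').
split; apply/matrixP => b b'.
  rewrite -(diag true) summxE; apply: eq_bigr => j _.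
  exact: (kraus5_coefE C j j b b').1.
have -> : (6%:R%:M : 'M[C]_5) b b' = 6%:R%:M b' b by rewrite !mxE eq_sym.
rewrite -(diag false) summxE.
by apply: eq_bigr => j _; rewrite (kraus5_coefE C j j b' b).2.
Qed.

(** * Tensor products *)

Lemma big_mxtens (V : nmodType) (m n : nat) (F : 'I_(m * n) -> V) :
  \sum_p F p = \sum_i \sum_s F (mxtens_index (i, s)).
Proof.
rewrite pair_bigA /= (reindex (@mxtens_index m n)) /=.
  by apply: eq_bigr => -[i s] _.
by exists (@mxtens_unindex m n) => p _; rewrite ?mxtens_indexK ?mxtens_unindexK.
Qed.

Lemma tensmx_scalar (C : pzRingType) (m n : nat) (a b : C) :
  a%:M *t b%:M = (a * b)%:M :> 'M[C]_(m * n).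
Proof.
apply/matrixP => p q; rewrite !mxE -[in RHS](can_eq (@mxtens_unindexK m n)).
by rewrite xpair_eqE; case: (_ == _); case: (_ == _); rewrite ?mulr1n ?mulr0n ?mulr0 ?mul0r.
Qed.

Lemma tensmx_ctr (C : numClosedFieldType) (m n p q : nat)
    (A : 'M[C]_(m, n)) (B : 'M[C]_(p, q)) : (A *t B)^t* = A^t* *t B^t*.
Proof. by rewrite trmx_tens map_mxT. Qed.

Lemma tensmx_sum (C : pzRingType) (r k m n p q : nat)
    (F : 'I_r -> 'M[C]_(m, n)) (G : 'I_k -> 'M[C]_(p, q)) :
  \sum_i \sum_s F i *t G s = (\sum_i F i) *t (\sum_s G s).
Proof.
apply/matrixP => a b; rewrite !mxE !summxE big_distrlr /=.
by apply: eq_bigr => i _; rewrite summxE; apply: eq_bigr => s _; rewrite mxE.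
Qed.

(** Fixing an entry of the first factor leaves a linear relation among the [G s t], whose
    coefficients must all vanish. *)
Lemma tensmx_comb_eq0 (C : numClosedFieldType) (r k m n : nat)
    (F : 'I_r -> 'I_r -> 'M[C]_m) (G : 'I_k -> 'I_k -> 'M[C]_n)
    (X : 'I_r * 'I_k -> 'I_r * 'I_k -> C) :
  (forall Y : 'M[C]_k, \sum_s \sum_t Y s t *: G s t = 0 -> Y = 0) ->
  \sum_i \sum_s \sum_j \sum_t X (i, s) (j, t) *: (F i j *t G s t) = 0 ->
  forall s t, \sum_i \sum_j X (i, s) (j, t) *: F i j = 0.
Proof.
move=> indG X0 s t; apply/matrixP => b b'.
pose Y : 'M[C]_k := \matrix_(s, t) (\sum_i \sum_j X (i, s) (j, t) *: F i j) b b'.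
suff Y0 : Y = 0 by have /matrixP/(_ s t) := Y0; rewrite !mxE.
apply: indG; apply/matrixP => c c'.
have /matrixP/(_ (mxtens_index (b, c)) (mxtens_index (b', c'))) := X0.
rewrite [RHS]mxE => X0'; rewrite [RHS]mxE -[RHS]X0' !summxE.
under [RHS]eq_bigr do rewrite summxE.
rewrite [RHS]exchange_big; apply: eq_bigr => {}s _ /=; rewrite summxE.
under [RHS]eq_bigr => i _.
  rewrite summxE; under eq_bigr do rewrite summxE.
  rewrite exchange_big; over.
rewrite [RHS]exchange_big; apply: eq_bigr => {}t _ /=.
rewrite !mxE summxE mulr_suml; apply: eq_bigr => i _.
rewrite summxE mulr_suml; apply: eq_bigr => j _.
by rewrite !mxE !mxtens_indexK mulrA.
Qed.

(** Products of tensors factor, so independence of the [W] products on each side strips off [W]: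
    each block of [X] at fixed [(s, t)] solves both equations for [V]. *)
Lemma tensmx_independent (C : numClosedFieldType) (d1 d2 r e1 e2 k : nat)
    (V : 'I_r -> 'M[C]_(d1, d2)) (W : 'I_k -> 'M[C]_(e1, e2)) :
  kraus_independent V ->
  (forall X : 'M[C]_k, \sum_s \sum_t X s t *: ((W s)^t* *m W t) = 0 -> X = 0) ->
  (forall X : 'M[C]_k, \sum_s \sum_t X s t *: (W t *m (W s)^t*) = 0 -> X = 0) ->
  kraus_independent (fun p => V (mxtens_unindex p).1 *t W (mxtens_unindex p).2).
Proof.
move=> indV inW outW X inX outX.
pose x p q := X (mxtens_index p) (mxtens_index q).
suff X0 s t : \matrix_(i, j) x (i, s) (j, t) = 0.
  apply/matrixP => p q; case: (mxtens_indexP p) => i s; case: (mxtens_indexP q) => j t.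
  by have /matrixP/(_ i j) := X0 s t; rewrite !mxE.
apply: indV.
  under eq_bigr do under eq_bigr do rewrite mxE.
  apply: (tensmx_comb_eq0 (F := fun i j => (V i)^t* *m V j) inW).
  rewrite -[RHS]inX big_mxtens; apply: eq_bigr => i _; apply: eq_bigr => {}s _.
  rewrite big_mxtens; apply: eq_bigr => j _; apply: eq_bigr => {}t _.
  by rewrite !mxtens_indexK /= tensmx_ctr tensmx_mul.
under eq_bigr do under eq_bigr do rewrite mxE.
apply: (tensmx_comb_eq0 (F := fun i j => V j *m (V i)^t*) outW).
rewrite -[RHS]outX big_mxtens; apply: eq_bigr => i _; apply: eq_bigr => {}s _.
rewrite big_mxtens; apply: eq_bigr => j _; apply: eq_bigr => {}t _.
by rewrite !mxtens_indexK /= tensmx_ctr tensmx_mul.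
Qed.

Lemma scalemx_ctr (C : numClosedFieldType) (m n : nat) (a : C) (A : 'M[C]_(m, n)) :
  (a *: A)^t* = a^* *: A^t*.
Proof. by rewrite linearZ /= map_mxZ. Qed.

Lemma kraus_independentZ (C : numClosedFieldType) (d1 d2 r : nat)
    (V : 'I_r -> 'M[C]_(d1, d2)) (a : C) :
  a != 0 -> kraus_independent V -> kraus_independent (fun j => a *: V j).
Proof.
move=> a0 indV X inX outX.
have aa0 : a^* * a != 0 by rewrite mulf_neq0 // conjC_eq0.
apply: indV; apply: (scalerI aa0).
  rewrite scaler0 -[RHS]inX scaler_sumr; apply: eq_bigr => i _.
  rewrite scaler_sumr; apply: eq_bigr => j _.
  by rewrite scalemx_ctr -scalemxAl -scalemxAr !scalerA; congr (_ *: _); ring.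
rewrite scaler0 -[RHS]outX scaler_sumr; apply: eq_bigr => i _.
rewrite scaler_sumr; apply: eq_bigr => j _.
by rewrite scalemx_ctr -scalemxAl -scalemxAr !scalerA; congr (_ *: _); ring.
Qed.

(** * The family of [7 k] Kraus operators in dimension [5 k] *)

Definition kraus_5_7 (C : numClosedFieldType) (k : nat) (p : 'I_(7 * k)) : 'M[C]_(5 * k) :=
  kraus5_mx C (mxtens_unindex p).1 *t star_mx C (mxtens_unindex p).2.

Lemma kraus_5_7_independent (C : numClosedFieldType) (k : nat) :
  (2 < k)%N -> kraus_independent (@kraus_5_7 C k).
Proof.
move=> k_gt2; apply: tensmx_independent (@kraus5_independent C) _ _ => X.
  under eq_bigr do under eq_bigr do rewrite star_mx_ctr.
  exact: star_mx_independent.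
under eq_bigr do under eq_bigr do rewrite star_mx_ctr.
(* The factors are self-adjoint, so reversing their order amounts to transposing [X]. *)
move=> X0; apply: trmx_inj; rewrite trmx0; apply: star_mx_independent => //.
rewrite -[RHS]X0 exchange_big; apply: eq_bigr => s _; apply: eq_bigr => t _.
by rewrite mxE.
Qed.

Lemma kraus_5_7_marginals (C : numClosedFieldType) (k : nat) :
  let c := 6%:R * (k%:R * (star_coef C k ^+ 2 + 1)) in
  \sum_p (@kraus_5_7 C k p)^t* *m kraus_5_7 C p = c%:M /\
  \sum_p kraus_5_7 C p *m (@kraus_5_7 C k p)^t* = c%:M.
Proof.
move=> c; have [in5 out5] := kraus5_marginals C.
rewrite /c -tensmx_scalar -star_mx_sqr_sum; split.
  rewrite -in5 -tensmx_sum big_mxtens; apply: eq_bigr => i _; apply: eq_bigr => s _.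
  by rewrite /kraus_5_7 !mxtens_indexK tensmx_ctr tensmx_mul star_mx_ctr.
rewrite -out5 -tensmx_sum big_mxtens; apply: eq_bigr => i _; apply: eq_bigr => s _.
by rewrite /kraus_5_7 !mxtens_indexK tensmx_ctr tensmx_mul star_mx_ctr.
Qed.

Lemma exists_kraus_5_7 (C : numClosedFieldType) (k : nat) (b : C) :
  (2 < k)%N -> 0 < b ->
  exists V : 'I_(7 * k) -> 'M[C]_(5 * k),
    [/\ kraus_independent V, \sum_p (V p)^t* *m V p = b%:M
      & \sum_p V p *m (V p)^t* = b%:M].
Proof.
move=> k_gt2 b_gt0; have [in57 out57] := kraus_5_7_marginals C k.
move: in57 out57; set c := 6%:R * _ => in57 out57.
have c_gt0 : 0 < c.
  rewrite !mulr_gt0 ?ltr0n //; first by lia.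
  by rewrite ltr_wpDl // -realEsqr star_coef_real.
set a := sqrtC (b / c).
have a_gt0 : 0 < a by rewrite sqrtC_gt0 divr_gt0.
have aa : a^* * a * c = b.
  by rewrite conj_Creal ?gtr0_real // -expr2 sqrtCK divfK // gt_eqF.
exists (fun p => a *: kraus_5_7 C p); split.
- by apply: kraus_independentZ; [rewrite gt_eqF | exact: kraus_5_7_independent].
- rewrite -aa -scale_scalar_mx -in57 scaler_sumr; apply: eq_bigr => p _.
  by rewrite scalemx_ctr -scalemxAl -scalemxAr scalerA.
- rewrite -aa -scale_scalar_mx -out57 scaler_sumr; apply: eq_bigr => p _.
  by rewrite scalemx_ctr -scalemxAl -scalemxAr scalerA mulrC.
Qed.

(** * The maximal Choi-rank *)

Local Open Scope complex_scope.

Theorem corollary4p11 (R : realType) (k : nat) (hk : (3 <= k <= 14)%N) :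
  let A : 'M[R[i]]_(5 * k) := (5 * k)%:R^-1 *: 1%:M in
  MR A A = ((7 * k)%:R : R)%:E /\
  (7 * k)%N%:Z = Num.floor (Num.sqrt ((5 * k)%:R ^+ 2 + (5 * k)%:R ^+ 2 - 1 : R)).
Proof.
move=> A; have /andP[k_ge3 k_le14] := hk; split; last first.
  apply/esym/floor_def; rewrite -!natrX -natrD.
  have -> : (((5 * k) ^ 2 + (5 * k) ^ 2)%N%:R - 1 : R) = (50 * k ^ 2 - 1)%N%:R.
    by rewrite natrB ?muln_gt0 ?expn_gt0 ?(ltn_trans _ k_ge3) //; congr (_%:R - 1); lia.
  have -> : (7 * k)%N%:Z%:~R = Num.sqrt ((7 * k) ^ 2)%N%:R :> R.
    by rewrite natrX sqrtr_sqr ger0_norm // pmulrn.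
  have -> : ((7 * k)%N%:Z + 1)%:~R = Num.sqrt ((7 * k + 1) ^ 2)%N%:R :> R.
    by rewrite natrX sqrtr_sqr ger0_norm // pmulrn PoszD.
  rewrite ler_sqrt ?ler0n // ltr_sqrt ?ltr0n ?expn_gt0 ?addn1 // ler_nat ltr_nat.
  (* The upper inequality [50 k^2 - 1 < (7 k + 1)^2] means [k^2 < 14 k + 2], that is [k <= 14]. *)
  by apply/andP; split; nia.
have d_gt0 : (0 < 5 * k)%N by lia.
apply/eqP; rewrite eq_le; apply/andP; split.
  apply: ge_ereal_sup => _ [Phi extPhi <-]; rewrite lee_fin ler_nat.
  (* A rank of at least [7 k + 1] would give [(7 k + 1)^2 < 50 k^2], which fails for [k <= 14]. *)
  have := extreme_choi_rank_lt d_gt0 extPhi; nia.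
have AE : A = (5 * k)%:R^-1%:M by rewrite /A scalemx1.
have [||V [indV inV outV]] := @exists_kraus_5_7 R[i] k (5 * k)%:R^-1; first by [].
  by rewrite invr_gt0 ltr0n.
rewrite -(independent_choi_rank indV); apply: ereal_sup_ubound.
exists (sandwich V 1%:M) => //; apply: independent_extreme => //.
by apply/CP_set_sandwich1; rewrite AE.
Qed.
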